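(* Almost every set of $d+2$ points on the $(d-1)$-sphere $S^{d-1} \subset \mathbf{R}^d$ is not affinely subtransitive.
   Context: $S^{d-1}$ denotes the unit sphere in $\mathbf{R}^d$. ''Almost every'' means: if $x_0,\ldots,x_{d+1}$ are chosen independently and uniformly at random from $S^{d-1}$, then almost surely $\{x_0,\ldots,x_{d+1}\}$ is not affinely subtransitive. A finite set $T \subset \mathbf{R}^n$ is called transitive if it has a transitive group of symmetries, i.e. for all $s,t \in T$ there is an isometry $g$ of $\mathbf{R}^n$ with $g(T) = T$ and $g(s) = t$. A finite set $X \subset \mathbf{R}^d$ is called affinely subtransitive if it is mapped into a transitive set by a nonconstant affine map; that is, there exist an $n$ (possibly $n > d$), a finite transitive set $T \subset \mathbf{R}^n$, and a nonconstant affine map $f : \mathbf{R}^d \to \mathbf{R}^n$, $f(x) = Ax + b$ with $A \in \mathbf{R}^{n \times d}$ and $b \in \mathbf{R}^n$, such that $f(X) \subset T$.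
   Formalization: The formal theorem assumes d ≥ 2: for d = 1 the claim is false, since all points lie in the transitive set S^0 = {-1, 1}, and for d = 0 the sphere is empty. *)

(* Defs.v *)
From HB Require Import structures.
From mathcomp Require Import all_boot all_order all_algebra.
From mathcomp Require Import all_classical all_reals all_analysis.

Set Implicit Arguments.
Unset Strict Implicit.
Unset Printing Implicit Defensive.

Import Order.TTheory GRing.Theory Num.Theory.
Import numFieldNormedType.Exports.

Local Open Scope classical_set_scope.
Local Open Scope ring_scope.

(* The library norm on matrices is the sup norm, hence a separate Euclidean
   norm. *)
Definition enorm (R : realType) (n : nat) (x : 'cV[R]_n) : R :=
  Num.sqrt (\sum_(i < n) x i ord0 ^+ 2).

Definition unit_sphere (R : realType) (d : nat) : set 'cV[R]_d :=
  [set x | enorm x = 1].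

Definition isometry (R : realType) (n : nat) (g : 'cV[R]_n -> 'cV[R]_n) : Prop :=
  forall x y, enorm (g x - g y) = enorm (x - y).

Definition transitive_set (R : realType) (n : nat) (T : set 'cV[R]_n) : Prop :=
  finite_set T /\
  forall s t, T s -> T t ->
    exists g : 'cV[R]_n -> 'cV[R]_n, [/\ isometry g, g @` T = T & g s = t].

Definition affine_map (R : realType) (d n : nat) (f : 'cV[R]_d -> 'cV[R]_n) : Prop :=
  exists (A : 'M[R]_(n, d)) (b : 'cV[R]_n), forall x, f x = A *m x + b.

Definition nonconstant (U V : Type) (f : U -> V) : Prop :=
  exists x y, f x <> f y.

Definition affinely_subtransitive (R : realType) (d : nat) (X : set 'cV[R]_d) : Prop :=
  exists (n : nat) (T : set 'cV[R]_n) (f : 'cV[R]_d -> 'cV[R]_n),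
    [/\ transitive_set T, affine_map f, nonconstant f & f @` X `<=` T].

(* R^d with its Borel sigma-algebra. *)
Definition borel_cV (R : realType) (d : nat) :=
  g_sigma_algebraType (@open 'cV[R]_d).

(* The uniform law on S^(d-1): the Borel probability measure on R^d
   concentrated on the sphere and invariant under the orthogonal group. *)
Definition uniform_on_sphere (R : realType) (d : nat)
    (mu : probability (borel_cV R d) R) : Prop :=
  mu (@unit_sphere R d) = 1%E /\
  forall Q : 'M[R]_d, Q^T *m Q = 1%:M ->
    forall B : set (borel_cV R d), measurable B ->
      mu [set x : borel_cV R d | B (Q *m x)] = mu B.

Definition mutually_independent (R : realType) (dO dV : measure_display)
    (Omega : measurableType dO) (V : measurableType dV) (P : probability Omega R)
    (I : finType) (X : I -> {RV P >-> V}) : Prop :=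
  forall (J : {set I}) (B : I -> set V), (forall i, measurable (B i)) ->
    P (\bigcap_(i in [set` J]) (X i @^-1` B i)) =
    (\prod_(i in J) P (X i @^-1` B i))%E.

(* Main.v *)
(* Let x_0, ..., x_(d+1) be in general position and let c be its affine
   dependency, whose coefficients are polynomials in the x_i (Cramer). Suppose
   that an affine map f sends the x_i into a transitive set T. A permutation h
   of T preserving distances preserves affine dependencies between points of T,
   because the norm of an affine combination of weight 0 is determined by
   distances. So, choosing distance-preserving permutations s_j sending f(x_0)
   to f(x_j), the function F(h) = h(f(x_0)) satisfies
     sum_j c_j (F(h) - F(s_j h)) = 0,
   that is, F is in the kernel of the operator L(c) = sum_j c_j (1 - P_j) for
   permutation matrices P_j. When all c_j are 1, an energy argument shows that
   this kernel consists of the vectors invariant under all P_j; the failure of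
   this property is the vanishing of a polynomial in c, which is thus not zero.
   If it does not vanish at c, then F is invariant, f is constant on the x_i,
   hence constant. There are countably many tuples of permutation matrices, so
   it remains to see that a polynomial in the coordinates of the points which is
   not identically zero on the product of spheres is almost surely nonzero. As
   only the invariance of the uniform law is available, this is shown by a
   recurrence argument for the product of the rotation groups.

   The polynomial is not identically zero on spherical configurations: it does
   not vanish at c = (s, 1, ..., 1) for all but finitely many s, and infinitely
   many of these c are dependencies of the standard basis together with the two
   ends of a chord of the sphere through the centroid of the basis. *)

Require Import Defs.
From HB Require Import structures.
From mathcomp Require Import all_boot all_order all_algebra all_fingroup.
From mathcomp Require Import all_classical all_reals all_analysis.
From mathcomp Require Import measurable_realfun.
From mathcomp Require Import ring lra.

Set Implicit Arguments.
Unset Strict Implicit.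
Unset Printing Implicit Defensive.

Import Order.TTheory GRing.Theory Num.Theory.
Import numFieldNormedType.Exports.

Local Open Scope classical_set_scope.
Local Open Scope ring_scope.

(** * Permutation matrices *)

Section PermutationOperators.
Context {R : realFieldType} {m N : nat} (p : 'I_m -> 'S_N).
Implicit Types (c : 'I_m -> R) (F : 'cV[R]_N).

Definition perm_laplacian c : 'M[R]_N :=
  \sum_j c j *: (1%:M - perm_mx (p j)).

Definition perm_span : {group 'S_N} := <<(p @: 'I_m)%SET>>%G.

(** Up to the factor [#|perm_span|], the projector onto the invariant vectors. Its products with the
    Laplacian vanish on both sides. *)
Definition perm_average : 'M[R]_N := \sum_(g in perm_span) perm_mx g.

Definition perm_invariant F := forall j, perm_mx (p j) *m F = F.

Lemma mem_perm_span j : p j \in perm_span.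
Proof. by rewrite mem_gen// imset_f. Qed.

Lemma perm_mx_averageL g : g \in perm_span ->
  perm_mx g *m perm_average = perm_average.
Proof.
move=> gG; rewrite /perm_average mulmx_sumr.
rewrite [RHS](reindex_inj (mulgI g)) /=.
by apply: eq_big => h => [|_]; rewrite ?groupMl// perm_mxM.
Qed.

Lemma perm_mx_averageR g : g \in perm_span ->
  perm_average *m perm_mx g = perm_average.
Proof.
move=> gG; rewrite /perm_average mulmx_suml.
rewrite [RHS](reindex_inj (mulIg g)) /=.
by apply: eq_big => h => [|_]; rewrite ?groupMr// perm_mxM.
Qed.

Lemma perm_laplacian_average c : perm_laplacian c *m perm_average = 0.
Proof.
rewrite mulmx_suml big1// => j _.
by rewrite -scalemxAl mulmxBl mul1mx perm_mx_averageL ?subrr ?scaler0 ?mem_perm_span.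
Qed.

Lemma perm_average_laplacian c : perm_average *m perm_laplacian c = 0.
Proof.
rewrite mulmx_sumr big1// => j _.
by rewrite -scalemxAr mulmxBr mulmx1 perm_mx_averageR ?subrr ?scaler0 ?mem_perm_span.
Qed.

Lemma perm_average_sqr :
  perm_average *m perm_average = #|perm_span|%:R *: perm_average.
Proof.
rewrite {1}/perm_average mulmx_suml (eq_bigr (fun=> perm_average)); last first.
  by move=> g; exact: perm_mx_averageL.
by rewrite big_const iter_addr_0 scaler_nat.
Qed.

Lemma perm_span_neq0 : #|perm_span|%:R != 0 :> R.
Proof. by rewrite pnatr_eq0 -lt0n cardG_gt0. Qed.

Lemma perm_invariant_average F :
  perm_invariant F -> perm_average *m F = #|perm_span|%:R *: F.
Proof.
move=> invF.
have invG g : g \in perm_span -> perm_mx g *m F = F.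
  pose A := [set g : 'S_N | perm_mx g *m F == F]%SET.
  have gA : group_set A.
    apply/group_setP; split=> [|a b]; rewrite !inE ?perm_mx1 ?mul1mx//.
      by move=> /eqP aF /eqP bF; rewrite perm_mxM -mulmxA bF aF.
  have sGA : perm_span \subset Group gA.
    by rewrite gen_subG; apply/fintype.subsetP => _ /imsetP[j _ ->]; rewrite !inE invF.
  by move=> /(fintype.subsetP sGA); rewrite inE => /eqP.
rewrite mulmx_suml (eq_bigr (fun=> F))//.
by rewrite big_const iter_addr_0 scaler_nat.
Qed.

(* The second summand is injective on the invariant vectors, which are in the
   kernel of the first one. *)
Definition perm_det c : R := \det (perm_laplacian c + perm_average).

Lemma perm_det_neq0P c :
  reflect (forall F, perm_laplacian c *m F = 0 -> perm_average *m F = 0 -> F = 0)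
          (perm_det c != 0).
Proof.
apply: (iffP idP) => [det0 F LF JF|ker0].
  have U : perm_laplacian c + perm_average \in unitmx by rewrite unitmxE unitfE.
  by rewrite -(mulKmx U F) mulmxDl LF JF addr0 mulmx0.
apply/negP => /eqP det0.
have : \det (perm_laplacian c + perm_average)^T = 0 by rewrite det_tr.
move=> /eqP/det0P[v v0 vM].
suff : v^T = 0 by move=> /eqP; rewrite trmx_eq0 (negPf v0).
have /(congr1 trmx) := vM; rewrite trmx_mul trmxK trmx0 mulmxDl => MF.
(* Applying [perm_average] kills the Laplacian term and multiplies the other one by the order of the
   group, so both terms vanish. *)
have JF : perm_average *m v^T = 0.
  have : perm_average *m (perm_laplacian c *m v^T + perm_average *m v^T) = 0.
    by rewrite MF mulmx0.
  rewrite mulmxDr !mulmxA perm_average_laplacian mul0mx add0r perm_average_sqr.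
  by rewrite -scalemxAl => /eqP; rewrite scaler_eq0 (negPf perm_span_neq0) => /eqP.
by apply: ker0 => //; move: MF; rewrite JF addr0.
Qed.

Lemma perm_det_scale c a : a != 0 -> perm_det c != 0 ->
  perm_det (fun j => a * c j) != 0.
Proof.
move=> a0 /perm_det_neq0P ker0; apply/perm_det_neq0P => F LF; apply: ker0.
apply/eqP; move/eqP: LF; rewrite (_ : perm_laplacian _ = a *: perm_laplacian c).
  by rewrite -scalemxAl scaler_eq0 (negPf a0).
by rewrite scaler_sumr; apply: eq_bigr => j _; rewrite scalerA.
Qed.

Lemma perm_kernel_invariant c F :
  perm_det c != 0 -> perm_laplacian c *m F = 0 -> perm_invariant F.
Proof.
move=> /perm_det_neq0P ker0 LF j.
(* Up to scaling, the component of [F] complementary to the invariant vectors; both operators kill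
   it. *)
pose F' := #|perm_span|%:R *: F - perm_average *m F.
have /eqP : F' = 0.
  apply: ker0; rewrite mulmxBr -scalemxAr ?LF mulmxA.
    by rewrite perm_laplacian_average mul0mx scaler0 subrr.
  by rewrite perm_average_sqr -scalemxAl subrr.
rewrite subr_eq0 => /eqP FJ; apply: (scalerI perm_span_neq0).
by rewrite scalemxAr FJ mulmxA perm_mx_averageL// mem_perm_span.
Qed.

(* Permutation matrices are orthogonal, so <F, F - P F> is half of |F - P F|^2;
   with equal weights these nonnegative quantities add up to <F, L F> = 0. *)
Lemma perm_det1_neq0 : perm_det (fun=> 1) != 0.
Proof.
apply/perm_det_neq0P => F LF JF.
pose G j := F - perm_mx (p j) *m F.
have normP j : (perm_mx (p j) *m F)^T *m (perm_mx (p j) *m F) = F^T *m F.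
  by rewrite trmx_mul mulmxA -(mulmxA F^T) tr_perm_mx -perm_mxM mulVg perm_mx1 mulmx1.
have sumG : \sum_j ((G j)^T *m G j) 0 0 = 0.
  have symP j : (perm_mx (p j) *m F)^T *m F = (F^T *m (perm_mx (p j) *m F))^T.
    by rewrite [RHS]trmx_mul trmxK.
  have -> : \sum_j ((G j)^T *m G j) 0 0 =
            \sum_j 2 * (F^T *m G j) 0 0.
    apply: eq_bigr => j _; rewrite /G [(F - _)^T]linearB /= mulmxBl !mulmxBr normP symP.
    by rewrite !mxE; ring.
  rewrite -mulr_sumr.
  have -> : \sum_j (F^T *m G j) 0 0 = (F^T *m (perm_laplacian (fun=> 1) *m F)) 0 0.
    rewrite mulmx_suml mulmx_sumr summxE; apply: eq_bigr => j _.
    by rewrite scale1r /G mulmxBl mul1mx.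
  by rewrite LF mulmx0 mxE mulr0.
have normG_ge0 j : 0 <= ((G j)^T *m G j) 0 0.
  by rewrite mxE sumr_ge0// => i _; rewrite mxE -expr2 sqr_ge0.
have G0 j : G j = 0.
  have : ((G j)^T *m G j) 0 0 = 0 by apply: (psumr_eq0P _ sumG).
  rewrite mxE => Gj0; apply/matrixP => i k; rewrite ord1 [RHS]mxE.
  apply/eqP; rewrite -sqrf_eq0 expr2; apply/eqP.
  have : (G j)^T 0 i * G j i 0 = 0.
    by apply: (psumr_eq0P _ Gj0) => // l _; rewrite mxE -expr2 sqr_ge0.
  by rewrite mxE.
have invF : perm_invariant F.
  by move=> j; have /eqP := G0 j; rewrite subr_eq0 => /eqP/esym.
have := perm_invariant_average invF; rewrite JF => /esym/eqP.
by rewrite scaler_eq0 (negPf perm_span_neq0) => /eqP.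
Qed.

End PermutationOperators.

(** * Functions of finite type *)

Definition measure_preserving {d} {T : measurableType d} {R : realType}
    (mu : {measure set T -> \bar R}) (s : T -> T) : Prop :=
  measurable_fun setT s /\
  forall A, measurable A -> mu (s @^-1` A) = mu A.

Lemma measure_preserving_iter {d} {T : measurableType d} {R : realType}
    (mu : {measure set T -> \bar R}) (s : T -> T) n :
  measure_preserving mu s -> measure_preserving mu (iter n s).
Proof.
move=> [ms mus]; elim: n => [|n [IHm IHmu]]; first by split=> // A; exact: measurable_id.
split=> [|A mA]; first exact: measurableT_comp.
rewrite -[LHS]/(mu (iter n s @^-1` (s @^-1` A))) IHmu ?mus//.
by rewrite -[_ @^-1` _]setTI; exact: ms.
Qed.

(* A quantitative Poincare recurrence: the return time is bounded in terms of
   the measure of [A] only, uniformly in the transformation. *)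
Lemma bounded_recurrence {d} {T : measurableType d} {R : realType}
    (P : probability T R) (A : set T) : measurable A -> P A != 0%E ->
  exists K, forall s, measure_preserving P s ->
    exists2 m, (0 < m <= K)%N & P (A `&` iter m s @^-1` A) != 0%E.
Proof.
move=> mA PA0.
have PAfin : P A \is a fin_num by rewrite fin_num_measure.
have v0 : 0 < fine (P A).
  by rewrite fine_gt0// lt0e PA0 measure_ge0/= -ge0_fin_numE.
have [K vK] : exists K : nat, 1 < fine (P A) *+ K.
  exists (Num.truncn (fine (P A))^-1).+1.
  by rewrite -mulr_natr -ltr_pdivrMl// mulr1 truncnS_gt.
exists K => s mps; apply: contrapT => norec.
have rec0 m : (m < K)%N -> P (A `&` iter m.+1 s @^-1` A) = 0%E.
  move=> mK; apply: contrapT => PA; apply: norec; exists m.+1 => //; exact/eqP.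
have mpre n B : measurable B -> measurable (iter n s @^-1` B).
  have [ms _] := measure_preserving_iter n mps.
  by move=> mB; rewrite -[_ @^-1` _]setTI; exact: ms.
pose U := \bigcup_(m < K) (A `&` iter m.+1 s @^-1` A).
have mU : measurable U.
  by apply: bigcup_measurable => m _; apply: measurableI => //; exact: mpre.
have PU0 : P U = 0%E.
  apply/eqP; rewrite eq_le measure_ge0 andbT /U bigcup_mkord.
  rewrite (le_trans (@Boole_inequality _ _ _ P (fun m => A `&` iter m.+1 s @^-1` A) _ _))//.
    by move=> i iK; apply: measurableI => //; exact: mpre.
  by rewrite big1// => i _; exact: rec0.
(* The points of [A] that do not come back within [K] steps. If the claim fails, their preimages by
   the iterates of order below [K] are disjoint and all have measure [P A], for a total above 1. *)
pose D := A `\` U.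
have mD : measurable D by exact: measurableD.
have PD : P D = P A.
  apply/eqP; rewrite eq_le le_measure ?inE//=; last exact: subDsetl.
  rewrite (measureDI P mA mU) -[leRHS]adde0 leeD2l// -PU0.
  by rewrite le_measure ?inE//; exact: measurableI.
have tD : trivIset `I_K (fun i => iter i s @^-1` D).
  suff H i j x : (i < j)%N -> (j < K)%N ->
      ~ (D (iter i s x) /\ D (iter j s x)).
    move=> i j /= iK jK [x [Di Dj]]; apply/eqP; rewrite eqn_leq leqNgt [X in _ && X]leqNgt.
    by apply/andP; split; apply/negP => ij; [apply: (H j i x)|apply: (H i j x)].
  move=> ij jK [[Ai Ui] [Aj _]]; apply: Ui.
  exists (j - i).-1 => /=; first by rewrite prednK ?subn_gt0// (leq_trans (leq_subr _ _))// ltnW.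
  by split => //; rewrite -iterS prednK ?subn_gt0// -iterD subnK// ltnW.
have : (P (\bigcup_(i < K) (iter i s @^-1` D)) <= 1)%E.
  apply: probability_le1; apply: bigcup_measurable => i _; exact: mpre.
rewrite measure_fin_bigcup//; last by move=> i _; exact: mpre.
rewrite (eq_fsbigr (fun=> (fine (P A))%:E)); last first.
  move=> i _; have [_ /(_ D mD) PiD] := measure_preserving_iter i mps.
  by rewrite fineK// -PD.
rewrite -fsbig_ord sumEFin lee_fin sumr_const card_ord => /(lt_le_trans vK).
by rewrite ltxx.
Qed.

(* The entries of [phi] span a space of functions stable under composition with
   [Gam]; for a linear action, polynomial functions are of this kind. *)
Definition finite_type_fun {d} {T : measurableType d} {R : realType}
    (Gam : set (T -> T)) (q : T -> R) : Prop :=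
  exists (M : nat) (phi : T -> 'cV[R]_M) (a : 'rV[R]_M),
    [/\ forall j, measurable_fun setT (fun y => phi y j 0),
        forall g, Gam g -> exists B : 'M[R]_M, forall y, phi (g y) = B *m phi y &
        forall y, q y = (a *m phi y) 0 0].

Lemma measurable_zero_mulmx {d} {T : measurableType d} {R : realType} {k M}
    (phi : T -> 'cV[R]_M) (W : 'M[R]_(k, M)) :
  (forall j, measurable_fun setT (fun y => phi y j 0)) ->
  measurable [set y | W *m phi y = 0].
Proof.
move=> mphi.
have -> : [set y | W *m phi y = 0] =
    \bigcap_(i in [set: 'I_k]) ((fun y => (W *m phi y) i 0) @^-1` [set 0]).
  apply/seteqP; split=> [y Wy i _|y Wy] /=; first by rewrite Wy mxE.
  by apply/matrixP => i j; rewrite ord1 [RHS]mxE; exact: Wy.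
apply: fin_bigcap_measurable => // i _; rewrite -[_ @^-1` _]setTI.
apply: (_ : measurable_fun setT _) => //; under eq_fun do rewrite mxE.
by apply: measurable_sum => j; apply: measurable_funM.
Qed.

(* Among the linear systems implying [q = 0] and satisfied with positive
   probability, take one of maximal rank. By recurrence, a root [s] of a
   transformation [g] returns the solution set [Z] to itself, up to positive
   measure, in [m] steps; maximality then makes [Z] stable under [iter m s],
   hence under [g] if [m] divides the order of the root. *)
Lemma finite_type_fun_null {d} {T : measurableType d} {R : realType}
    (P : probability T R) (Gam : set (T -> T)) (S : set T) (q : T -> R) :
  (forall g, Gam g -> measure_preserving P g) ->
  (forall g K, Gam g -> (0 < K)%N -> exists2 s, Gam s & iter K s = g) ->
  measurable S -> P S = 1%E ->
  (forall A : set T, (forall g y, Gam g -> A y -> A (g y)) -> A `&` S !=set0 ->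
    S `<=` A) ->
  finite_type_fun Gam q -> (exists2 y, S y & q y != 0) ->
  measurable [set y | q y = 0] /\ P [set y | q y = 0] = 0%E.
Proof.
move=> Gmp Groot mS PS1 Gtr [M [phi [a [mphi Gphi qE]]]] [y0 Sy0 qy0].
pose Z k (W : 'M[R]_(k, M)) := [set y | W *m phi y = 0].
have mZ k (W : 'M[R]_(k, M)) : measurable (Z k W) by exact: measurable_zero_mulmx.
have ZE : [set y | q y = 0] = Z _ a.
  apply/seteqP; split=> y; rewrite /Z/= qE; last by move=> ->; rewrite mxE.
  by move=> ay0; apply/matrixP => i j; rewrite !ord1 ay0 mxE.
rewrite ZE; split; first exact: mZ.
apply/eqP/negPn/negP => Pa0.
pose good (r : nat) := `[< exists W : 'M[R]_M,
  [/\ \rank W = r, (a <= W)%MS & (P (Z _ W) != 0)%E] >].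
have exgood : exists r, good r.
  exists (\rank <<a>>%MS); apply/asboolP; exists <<a>>%MS; split => //.
    by rewrite genmxE.
  rewrite (_ : Z _ _ = Z _ a)//; apply/seteqP; split=> y; rewrite /Z/= => Wy.
    have /submxP[D ->] : (a <= <<a>>)%MS by rewrite genmxE.
    by rewrite -mulmxA Wy mulmx0.
  have /submxP[D ->] : (<<a>> <= a)%MS by rewrite genmxE.
  by rewrite -mulmxA Wy mulmx0.
have bound r : good r -> (r <= M)%N by move=> /asboolP[W [<- _ _]]; exact: rank_leq_row.
have [r /asboolP[W [Wr aW PW]] Wmax] := ex_maxnP exgood bound.
have ZW k (V : 'M[R]_(k, M)) : (V <= W)%MS -> Z _ W `<=` Z _ V.
  by move=> /submxP[D ->] y Wy; rewrite /Z/= -mulmxA Wy mulmx0.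
have iterB s n : Gam s -> exists B : 'M[R]_M, forall y, phi (iter n s y) = B *m phi y.
  move=> /Gphi[B Bs]; elim: n => [|n [C Cs]]; first by exists 1%:M => y; rewrite mul1mx.
  by exists (B *m C) => y; rewrite iterS Bs Cs mulmxA.
have [K recK] := bounded_recurrence (mZ _ W) PW.
have Zstable g y : Gam g -> Z _ W y -> Z _ W (g y).
  (* As [K] is uniform in the transformation, the root can be taken of order [K!], a multiple of
     every possible return time. *)
  move=> Gg; have [s Gs sg] := Groot _ _ Gg (fact_gt0 K).
  have [m /andP[m0 mK] Pm] := recK _ (Gmp _ Gs).
  have [B Bs] := iterB s m Gs.
  (* The system [W + W *m B] defines the points of [Z _ W] that are back after [m] steps, a set of
     positive measure; by maximality it has no new equation. *)
  have WB : (W *m B <= W)%MS.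
    have sW : (W <= W + W *m B)%MS by exact: addsmxSl.
    suff : good (\rank (W + W *m B)%MS).
      move=> /Wmax; rewrite -Wr => rle.
      have /mxrank_leqif_sup[_] := sW.
      rewrite eqn_leq rle mxrankS//= => /esym/(submx_trans _); apply.
      exact: addsmxSr.
    apply/asboolP; exists (W + W *m B)%MS; split => //.
      exact: submx_trans aW sW.
    rewrite (_ : Z _ _ = Z _ W `&` iter m s @^-1` Z _ W)//.
    apply/seteqP; split=> x; rewrite /Z/=.
      move=> Wx; have /submxP[D1 E1] := sW.
      have /submxP[D2 E2] : (W *m B <= W + W *m B)%MS by exact: addsmxSr.
      split; first by rewrite E1 -mulmxA Wx mulmx0.
      by rewrite Bs mulmxA E2 -mulmxA Wx mulmx0.
    move=> [Wx]; rewrite Bs mulmxA => WBx.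
    have /sub_addsmxP[[D1 D2] ->] : (W + W *m B <= W + W *m B)%MS by [].
    by rewrite /= mulmxDl -[D1 *m _ *m _]mulmxA -[D2 *m _ *m _]mulmxA Wx WBx !mulmx0 addr0.
  have Zm n x : Z _ W x -> Z _ W (iter n (iter m s) x).
    elim: n => // n IH /IH Wx; rewrite iterS /Z/= Bs mulmxA.
    by have := ZW _ _ WB _ Wx.
  have /dvdnP[n Kn] : (m %| K`!)%N by apply: dvdn_fact; rewrite m0.
  move=> /(Zm n); rewrite -sg Kn.
  have -> // : iter n (iter m s) y = iter (n * m) s y.
  by elim: n {Kn} => // n IH; rewrite iterS IH -iterD mulSn.
(* A set of positive probability meets [S]; being stable, it then contains [S], hence [y0]. *)
have ZS : Z _ W `&` S !=set0.
  apply/set0P/negP => /eqP ZS0; move/negP: PW; apply.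
  rewrite (_ : P (Z _ W) = P (Z _ W `&` ~` S) + P (Z _ W `&` S))%E; last first.
    rewrite -measureDI//; exact: mZ.
  rewrite ZS0 measure0 adde0 -measure_le0.
  rewrite (@le_trans _ _ (P (~` S)))//.
    rewrite le_measure ?inE//; last exact: measurableC.
    by apply: measurableI; [exact: mZ|exact: measurableC].
  by rewrite probability_setC// PS1 subee.
have : q y0 = 0.
  have Wy0 := Gtr _ Zstable ZS _ Sy0.
  by rewrite qE (ZW _ _ aW _ Wy0) mxE.
by move/eqP; rewrite (negPf qy0).
Qed.

(** * Closure of functions of finite type under polynomial operations *)

Lemma finite_type_fun_eq {d} {T : measurableType d} {R : realType}
    (Gam : set (T -> T)) (q1 q2 : T -> R) :
  (forall y, q1 y = q2 y) -> finite_type_fun Gam q1 -> finite_type_fun Gam q2.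
Proof. by move=> /funext ->. Qed.

Lemma finite_type_fun_cst {d} {T : measurableType d} {R : realType}
    (Gam : set (T -> T)) (a : R) : finite_type_fun Gam (fun=> a).
Proof.
exists 1%N, (fun=> 1%:M), a%:M; split=> [j|g _|y].
- exact: measurable_cst.
- by exists 1%:M => y; rewrite mulmx1.
- by rewrite mulmx1 mxE eqxx mulr1n.
Qed.

Lemma finite_type_funD {d} {T : measurableType d} {R : realType}
    (Gam : set (T -> T)) (q1 q2 : T -> R) :
  finite_type_fun Gam q1 -> finite_type_fun Gam q2 ->
  finite_type_fun Gam (fun y => q1 y + q2 y).
Proof.
move=> [M1 [f1 [a1 [m1 G1 q1E]]]] [M2 [f2 [a2 [m2 G2 q2E]]]].
exists (M1 + M2)%N, (fun y => col_mx (f1 y) (f2 y)), (row_mx a1 a2); split.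
- move=> j; under eq_fun do rewrite mxE.
  by case: (fintype.split j) => k; [exact: m1|exact: m2].
- move=> g Gg; have [B1 B1E] := G1 g Gg; have [B2 B2E] := G2 g Gg.
  exists (block_mx B1 0 0 B2) => y.
  by rewrite mul_block_col !mul0mx addr0 add0r B1E B2E.
- by move=> y; rewrite mul_row_col mxE q1E q2E.
Qed.

(** Tensor product: a transformation acts on the outer product [X] of the two vectors of functions
    by the linear map [B1 *m X *m B2^T]. *)
Lemma finite_type_funM {d} {T : measurableType d} {R : realType}
    (Gam : set (T -> T)) (q1 q2 : T -> R) :
  finite_type_fun Gam q1 -> finite_type_fun Gam q2 ->
  finite_type_fun Gam (fun y => q1 y * q2 y).
Proof.
move=> [M1 [f1 [a1 [m1 G1 q1E]]]] [M2 [f2 [a2 [m2 G2 q2E]]]].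
exists (M1 * M2)%N, (fun y => (mxvec (f1 y *m (f2 y)^T))^T), (mxvec (a1^T *m a2)).
split.
- move=> j; under eq_fun do rewrite mxE.
  case/mxvec_indexP: j => i j; under eq_fun do rewrite mxvecE mxE big_ord1 !mxE.
  exact: measurable_funM.
- move=> g Gg; have [B1 B1E] := G1 g Gg; have [B2 B2E] := G2 g Gg.
  pose h (X : 'M[R]_(M1, M2)) := B1 *m X *m B2^T.
  have linh : linear h by move=> a X Y; rewrite /h mulmxDr -scalemxAr mulmxDl -scalemxAl.
  pose hL := GRing.isLinear.Build _ _ _ _ h linh.
  pose H : {linear 'M[R]_(M1, M2) -> 'M[R]_(M1, M2)} := HB.pack h hL.
  exists (lin_mx H)^T => y; rewrite -trmx_mul mul_vec_lin /= /h.
  by rewrite B1E B2E trmx_mul !mulmxA.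
- move=> y; rewrite q1E q2E !mxE big_distrlr /= pair_big /=.
  rewrite (reindex _ (curry_mxvec_bij _ _)) /=.
  apply: eq_bigr => -[i j] _ /=; rewrite mxE !mxvecE !mxE !big_ord1 !mxE.
  by rewrite mulrACA.
Qed.

Lemma finite_type_fun_sum {d} {T : measurableType d} {R : realType}
    (Gam : set (T -> T)) (I : Type) (r : seq I) (q : I -> T -> R) :
  (forall i, finite_type_fun Gam (q i)) ->
  finite_type_fun Gam (fun y => \sum_(i <- r) q i y).
Proof.
move=> fq; elim: r => [|i r IH].
  by under eq_fun do rewrite big_nil; exact: finite_type_fun_cst.
by under eq_fun do rewrite big_cons; exact: finite_type_funD.
Qed.

Lemma finite_type_fun_prod {d} {T : measurableType d} {R : realType}
    (Gam : set (T -> T)) (I : Type) (r : seq I) (q : I -> T -> R) :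
  (forall i, finite_type_fun Gam (q i)) ->
  finite_type_fun Gam (fun y => \prod_(i <- r) q i y).
Proof.
move=> fq; elim: r => [|i r IH].
  by under eq_fun do rewrite big_nil; exact: finite_type_fun_cst.
by under eq_fun do rewrite big_cons; exact: finite_type_funM.
Qed.

Lemma finite_type_fun_det {d} {T : measurableType d} {R : realType}
    (Gam : set (T -> T)) n (A : T -> 'M[R]_n) :
  (forall i j, finite_type_fun Gam (fun y => A y i j)) ->
  finite_type_fun Gam (fun y => \det (A y)).
Proof.
move=> fA; apply: finite_type_fun_sum => s.
by apply: finite_type_funM; [exact: finite_type_fun_cst|exact: finite_type_fun_prod].
Qed.

Lemma finite_type_fun_adj {d} {T : measurableType d} {R : realType}
    (Gam : set (T -> T)) n (A : T -> 'M[R]_n) i j :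
  (forall i j, finite_type_fun Gam (fun y => A y i j)) ->
  finite_type_fun Gam (fun y => (\adj (A y)) i j).
Proof.
move=> fA; under eq_fun do rewrite mxE.
apply: finite_type_funM; first exact: finite_type_fun_cst.
by apply: finite_type_fun_det => k l; under eq_fun do rewrite !mxE.
Qed.

(** * Configurations of points *)

Lemma continuous_bigsum {R : realType} (T : topologicalType) (I : Type) (r : seq I)
    (f : I -> T -> R) :
  (forall i, continuous (f i)) -> continuous (fun x => \sum_(i <- r) f i x).
Proof.
move=> cf; elim: r => [|i r IH] x.
  by under eq_fun do rewrite big_nil; apply: cvg_cst.
under eq_fun do rewrite big_cons.
by apply: cvgD; [exact: cf|exact: IH].
Qed.

Lemma continuous_mulmx {R : realType} k d (Q : 'M[R]_(k, d)) :
  continuous (fun v : 'cV[R]_d => Q *m v).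
Proof.
have ctsQ i j : continuous (fun v : 'cV[R]_d => (Q *m v) i j).
  under eq_fun do rewrite mxE.
  apply: continuous_bigsum => l v.
  apply: (@continuousM _ _ (fun=> Q i l) (fun v : 'cV[R]_d => v l j)).
    exact: cst_continuous.
  exact: coord_continuous.
move=> v A [P nP sPA].
have : \forall N \near v, forall i j, P i j ((Q *m N) i j).
  apply: (@filter_forall _ _ _ _ (nbhs_filter v)) => i.
  by apply: (@filter_forall _ _ _ _ (nbhs_filter v)) => j; exact: ctsQ.
by apply: (@filterS _ _ (nbhs_filter v)) => N PN; exact: sPA.
Qed.

Lemma measurable_borel_mulmx {R : realType} d (Q : 'M[R]_d) :
  measurable_fun setT ((fun v => Q *m v) : borel_cV R d -> borel_cV R d).
Proof.
apply: (measurability _ (erefl : @measurable _ (borel_cV R d) = _)) => _ [B oB <-].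
rewrite setTI; apply: sub_sigma_algebra.
by move: B oB; apply/continuousP; exact: continuous_mulmx.
Qed.

Lemma measurable_borel_entry {R : realType} d i j :
  measurable_fun setT ((fun v => v i j) : borel_cV R d -> R).
Proof.
apply: (measurability _ (RGenOpens.measurableE R)) => _ [_ [a [b ->]] <-].
rewrite setTI; apply: sub_sigma_algebra.
by apply: open_comp => [v _|]; [exact: coord_continuous|exact: interval_open].
Qed.

(** A pi-system generating the product sigma-algebra: a law on configurations is determined by its
    values there, which independence provides. *)
Definition rectangles (R : realType) n d : set (set ('I_n -> 'cV[R]_d)) :=
  [set A | exists2 B : 'I_n -> set (borel_cV R d), (forall i, measurable (B i)) &
     A = [set y | forall i, B i (y i)]].

Definition config (R : realType) n d := g_sigma_algebraType (@rectangles R n d).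

Lemma setI_closed_rectangles (R : realType) n d : setI_closed (@rectangles R n d).
Proof.
move=> _ _ [B mB ->] [C mC ->]; exists (fun i => B i `&` C i).
  by move=> i; exact: measurableI.
apply/seteqP; split=> [y [By Cy] i//|y BCy].
by split=> i; case: (BCy i).
Qed.

Lemma measurable_rectangle (R : realType) n d (B : 'I_n -> set (borel_cV R d)) :
  (forall i, measurable (B i)) ->
  measurable ([set y | forall i, B i (y i)] : set (config R n d)).
Proof. by move=> mB; apply: sub_sigma_algebra; exists B. Qed.

Lemma measurable_coord (R : realType) n d i :
  measurable_fun setT ((fun y => y i) : config R n d -> borel_cV R d).
Proof.
move=> _ B mB; rewrite setTI.
pose C j : set (borel_cV R d) := if j == i then B else setT.
rewrite (_ : _ @^-1` _ = [set y | forall j, C j (y j)]).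
  by apply: measurable_rectangle => j; rewrite /C; case: ifP.
apply/seteqP; split=> [y By j|y /(_ i)]; rewrite /C ?eqxx//.
by case: eqP => // ->.
Qed.

Lemma measurable_config (R : realType) n d d' (T : measurableType d')
    (f : T -> config R n d) :
  (forall i, measurable_fun setT ((fun t => f t i) : T -> borel_cV R d)) ->
  measurable_fun setT f.
Proof.
move=> mf; apply: (measurability _ (erefl : @measurable _ (config R n d) = _)).
move=> _ [_ [B mB ->] <-]; rewrite setTI.
rewrite (_ : _ @^-1` _ = \bigcap_(i in [set: 'I_n]) ((fun t => f t i) @^-1` B i)).
  apply: fin_bigcap_measurable => // i _.
  by rewrite -[_ @^-1` _]setTI; exact: mf.
by apply/seteqP; split=> [t Bt i _|t Bt i]; exact: Bt.
Qed.

Lemma config_probability_eq (R : realType) n d (m1 m2 : probability (config R n d) R) :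
  (forall B : 'I_n -> set (borel_cV R d), (forall i, measurable (B i)) ->
     m1 [set y | forall i, B i (y i)] = m2 [set y | forall i, B i (y i)]) ->
  forall A, measurable A -> m1 A = m2 A.
Proof.
move=> m12 A mA.
have setTr : @rectangles R n d setT.
  by exists (fun=> setT) => //; apply/seteqP; split.
apply: (@measure_unique _ R (config R n d) (@rectangles R n d) (fun=> setT)
  _ _ _ _ m1 m2) => //.
- exact: setI_closed_rectangles.
- by apply: bigcup_const; exists 0%N.
- by move=> _ [B mB ->]; exact: m12.
- by move=> _; rewrite (le_lt_trans (probability_le1 _ _))// ltry.
Qed.

(** * Rotations *)

Definition dotv {R : realType} {d} (x y : 'cV[R]_d) : R := (x^T *m y) 0 0.

Lemma dotvE {R : realType} d (x y : 'cV[R]_d) : dotv x y = \sum_i x i 0 * y i 0.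
Proof. by rewrite /dotv mxE; apply: eq_bigr => i _; rewrite mxE. Qed.

Lemma tr_mulmx_dotv {R : realType} d (x y : 'cV[R]_d) : x^T *m y = (dotv x y)%:M.
Proof. exact: mx11_scalar. Qed.

Lemma dotvC {R : realType} d (x y : 'cV[R]_d) : dotv x y = dotv y x.
Proof. by rewrite !dotvE; apply: eq_bigr => i _; rewrite mulrC. Qed.

Lemma dotvDr {R : realType} d (x y z : 'cV[R]_d) : dotv x (y + z) = dotv x y + dotv x z.
Proof. by rewrite /dotv mulmxDr mxE. Qed.

Lemma dotvZr {R : realType} d a (x y : 'cV[R]_d) : dotv x (a *: y) = a * dotv x y.
Proof. by rewrite /dotv -scalemxAr mxE. Qed.

Lemma dotvNr {R : realType} d (x y : 'cV[R]_d) : dotv x (- y) = - dotv x y.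
Proof. by rewrite -scaleN1r dotvZr mulN1r. Qed.

Lemma dotvDl {R : realType} d (x y z : 'cV[R]_d) : dotv (y + z) x = dotv y x + dotv z x.
Proof. by rewrite dotvC dotvDr !(dotvC x). Qed.

Lemma dotvZl {R : realType} d a (x y : 'cV[R]_d) : dotv (a *: x) y = a * dotv x y.
Proof. by rewrite dotvC dotvZr dotvC. Qed.

Lemma dotvNl {R : realType} d (x y : 'cV[R]_d) : dotv (- x) y = - dotv x y.
Proof. by rewrite dotvC dotvNr dotvC. Qed.

Lemma dotv_suml {R : realType} d (I : Type) (r : seq I) (x : I -> 'cV[R]_d) y :
  dotv (\sum_(i <- r) x i) y = \sum_(i <- r) dotv (x i) y.
Proof. by rewrite /dotv linear_sum mulmx_suml summxE. Qed.

Lemma dotv_sumr {R : realType} d (I : Type) (r : seq I) (x : I -> 'cV[R]_d) y :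
  dotv y (\sum_(i <- r) x i) = \sum_(i <- r) dotv y (x i).
Proof. by rewrite /dotv mulmx_sumr summxE. Qed.

Lemma dotvv_ge0 {R : realType} d (x : 'cV[R]_d) : 0 <= dotv x x.
Proof. by rewrite dotvE sumr_ge0// => i _; rewrite -expr2 sqr_ge0. Qed.

Lemma dotvv_eq0 {R : realType} d (x : 'cV[R]_d) : (dotv x x == 0) = (x == 0).
Proof.
apply/eqP/eqP => [|->]; last by rewrite dotvE big1// => i _; rewrite mxE mul0r.
rewrite dotvE => x0; apply/matrixP => i j; rewrite ord1 [RHS]mxE.
apply/eqP; rewrite -sqrf_eq0 expr2; apply/eqP.
by apply: (psumr_eq0P _ x0) => // k _; rewrite -expr2 sqr_ge0.
Qed.

Lemma enormE {R : realType} d (x : 'cV[R]_d) : enorm x = Num.sqrt (dotv x x).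
Proof. by rewrite /enorm dotvE; under eq_bigr do rewrite expr2. Qed.

Lemma enorm_inj {R : realType} d d' (x : 'cV[R]_d) (y : 'cV[R]_d') :
  enorm x = enorm y -> dotv x x = dotv y y.
Proof. by rewrite !enormE => /eqP; rewrite eqr_sqrt ?dotvv_ge0// => /eqP. Qed.

Lemma unit_sphereE {R : realType} d (x : 'cV[R]_d) :
  @unit_sphere R d x <-> dotv x x = 1.
Proof.
rewrite /unit_sphere/= enormE; split=> [xx|->]; last by rewrite sqrtr1.
by rewrite -(sqr_sqrtr (dotvv_ge0 x)) xx expr1n.
Qed.

Lemma unit_vector {R : realType} d (w : 'cV[R]_d) : w != 0 ->
  exists b v, [/\ 0 < b, dotv v v = 1 & w = b *: v].
Proof.
move=> w0; have ww : 0 < dotv w w by rewrite lt_neqAle dotvv_ge0 eq_sym dotvv_eq0 w0.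
have b0 : 0 < Num.sqrt (dotv w w) by rewrite sqrtr_gt0.
have bn0 : Num.sqrt (dotv w w) != 0 by rewrite gt_eqF.
exists (Num.sqrt (dotv w w)), ((Num.sqrt (dotv w w))^-1 *: w); split=> //.
  rewrite dotvZl dotvZr -[X in _ * (_ * X)](sqr_sqrtr (dotvv_ge0 w)).
  by field.
by rewrite scalerA divff ?scale1r.
Qed.

Lemma orthogonal_unit_vector {R : realType} d (x : 'cV[R]_d) : (2 <= d)%N ->
  exists2 v, dotv v v = 1 & dotv x v = 0.
Proof.
move=> d2.
have : kermx x != 0.
  rewrite -mxrank_eq0 mxrank_ker -lt0n subn_gt0 (leq_ltn_trans _ d2)//.
  exact: rank_leq_col.
case/rowV0Pn => r /sub_kermxP rx r0.
have [|b [v [b0 vv rv]]] := @unit_vector _ _ r^T; first by rewrite trmx_eq0.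
exists v => //; apply: (mulfI (lt0r_neq0 b0)); rewrite mulr0 -dotvZr -rv dotvC.
by rewrite /dotv trmxK rx mxE.
Qed.

(** For orthonormal [u] and [v], the rotation of their plane by the angle [t] from [u] towards [v],
    fixing the orthogonal complement. It is a one-parameter group in [t], the source of the
    roots. *)
Definition rotation {R : realType} {d} (u v : 'cV[R]_d) (t : R) : 'M[R]_d :=
  1%:M + (cos t - 1) *: (u *m u^T + v *m v^T) + sin t *: (v *m u^T - u *m v^T).

Definition orthonormal2 {R : realType} {d} (u v : 'cV[R]_d) :=
  [/\ dotv u u = 1, dotv v v = 1 & dotv u v = 0].

Lemma rotation0 {R : realType} d (u v : 'cV[R]_d) : rotation u v 0 = 1%:M.
Proof. by rewrite /rotation cos0 sin0 subrr !scale0r !addr0. Qed.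

Lemma rotationD {R : realType} d (u v : 'cV[R]_d) s t : orthonormal2 u v ->
  rotation u v s *m rotation u v t = rotation u v (s + t).
Proof.
move=> [uu vv uv].
have vu : dotv v u = 0 by rewrite dotvC.
have mulE (a b c e : 'cV[R]_d) : a *m b^T *m (c *m e^T) = dotv b c *: (a *m e^T).
  by rewrite mulmxA -(mulmxA a) tr_mulmx_dotv mul_mx_scalar scalemxAl.
rewrite /rotation cosD sinD.
(* [P] is the projector onto the plane and [J] its quarter turn; since [J *m J = - P], the claim
   becomes the addition formulas. *)
set P := u *m u^T + v *m v^T; set J := v *m u^T - u *m v^T.
have PP : P *m P = P.
  rewrite /P mulmxDl !mulmxDr !mulE uu vv uv vu.
  by rewrite !scale0r !scale1r addr0 add0r.
have PJ : P *m J = J.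
  rewrite /P /J mulmxDl !mulmxBr !mulE uu vv uv vu.
  by rewrite !scale0r !scale1r sub0r subr0 addrC.
have JP : J *m P = J.
  rewrite /P /J mulmxBl !mulmxDr !mulE uu vv uv vu.
  by rewrite !scale0r !scale1r addr0 add0r.
have JJ : J *m J = - P.
  rewrite /P /J mulmxBl !mulmxBr !mulE uu vv uv vu.
  by rewrite !scale0r !scale1r sub0r subr0 opprD addrC.
move: P J PP PJ JP JJ => P J PP PJ JP JJ.
rewrite !mulmxDl !mulmxDr !mul1mx !mulmx1 -!scalemxAl -!scalemxAr PP PJ JP JJ.
by apply/matrixP => i j; rewrite !mxE; ring.
Qed.

Lemma tr_rotation {R : realType} d (u v : 'cV[R]_d) t :
  (rotation u v t)^T = rotation u v (- t).
Proof.
rewrite /rotation cosN sinN; apply/matrixP => i j.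
by rewrite !mxE !big_ord1 !mxE eq_sym; ring.
Qed.

Lemma rotation_orthogonal {R : realType} d (u v : 'cV[R]_d) t : orthonormal2 u v ->
  (rotation u v t)^T *m rotation u v t = 1%:M.
Proof. by move=> uv; rewrite tr_rotation rotationD// addNr rotation0. Qed.

Lemma rotation_axis {R : realType} d (u v : 'cV[R]_d) t : orthonormal2 u v ->
  rotation u v t *m u = cos t *: u + sin t *: v.
Proof.
move=> [uu vv uv]; have vu : dotv v u = 0 by rewrite dotvC.
rewrite /rotation !mulmxDl mul1mx -!scalemxAl mulmxDl mulmxBl -!mulmxA.
rewrite !tr_mulmx_dotv uu vu !mul_mx_scalar !scale0r !scale1r.
by apply/matrixP => i j; rewrite !mxE; ring.
Qed.

Lemma rotation_transitive {R : realType} d (x y : 'cV[R]_d) : (2 <= d)%N ->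
  dotv x x = 1 -> dotv y y = 1 ->
  exists v t, orthonormal2 x v /\ rotation x v t *m x = y.
Proof.
move=> d2 xx yy.
suff [a [b [v [b0 vv xv yE]]]] : exists a b v,
    [/\ 0 <= b, dotv v v = 1, dotv x v = 0 & y = a *: x + b *: v].
  have ab : a ^+ 2 + b ^+ 2 = 1.
    move: yy; rewrite yE !dotvDl !dotvDr !dotvZl !dotvZr (dotvC v) xx vv xv => <-.
    by ring.
  have a1 : -1 <= a <= 1.
    by rewrite -ler_norml -(expr_le1 (n := 2))// real_normK ?num_real// -ab lerDl sqr_ge0.
  exists v, (acos a); split=> //.
  rewrite rotation_axis// acosK ?in_itv//= sin_acos// yE.
  by rewrite -ab addrAC subrr add0r sqrtr_sqr ger0_norm.
pose w := y - dotv x y *: x.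
have yE : y = dotv x y *: x + w by rewrite addrC subrK.
(* If [y] is parallel to [x], any unit vector orthogonal to [x] serves; there is one because
   [d >= 2]. *)
have [w0|/unit_vector[b [v [b0 vv wE]]]] := eqVneq w 0.
  have [v vv xv] := orthogonal_unit_vector x d2.
  by exists (dotv x y), 0, v; split => //; rewrite scale0r {1}yE w0.
exists (dotv x y), b, v; split; rewrite ?ltW// -?wE//.
apply: (mulfI (lt0r_neq0 b0)); rewrite mulr0 -dotvZr -wE.
by rewrite dotvDr dotvNr dotvZr xx mulr1 subrr.
Qed.

Definition config_rotation {R : realType} {n d} (i : 'I_n) (Q : 'M[R]_d)
    (y : config R n d) : config R n d :=
  fun j => if j == i then Q *m y j else y j.

(** Generators of the product of the rotation groups: each has roots of all orders of the same kind,
    and stability under them suffices to pass between spherical configurations. *)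
Definition config_rotations (R : realType) n d : set (config R n d -> config R n d) :=
  [set g | exists i u v t, orthonormal2 u v /\ g = config_rotation i (rotation u v t)].

Definition sphere_config (R : realType) n d : set (config R n d) :=
  [set y | forall i, @unit_sphere R d (y i)].

Lemma config_rotations_root {R : realType} n d (g : config R n d -> config R n d) K :
  config_rotations g -> (0 < K)%N ->
  exists2 s, config_rotations s & iter K s = g.
Proof.
move=> [i [u [v [t [uv ->]]]]] K0.
exists (config_rotation i (rotation u v (t / K%:R))); first by exists i, u, v, (t / K%:R).
have iterE m y : iter m (config_rotation i (rotation u v (t / K%:R))) y =
    config_rotation i (rotation u v (m%:R * (t / K%:R))) y.
  elim: m => [|m IH] /=; rewrite ?IH; apply/funext => j; rewrite /config_rotation.
    by rewrite mul0r rotation0 mul1mx; case: ifP.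
  by case: (j == i) => //; rewrite mulmxA rotationD// -[m.+1]add1n natrD mulrDl mul1r.
apply/funext => y; rewrite iterE mulrC divfK// pnatr_eq0.
by rewrite -lt0n.
Qed.

Lemma config_rotations_transitive {R : realType} n d (A : set (config R n d)) :
  (2 <= d)%N ->
  (forall g y, config_rotations g -> A y -> A (g y)) ->
  A `&` @sphere_config R n d !=set0 -> @sphere_config R n d `<=` A.
Proof.
move=> d2 stA [y [Ay Sy]] z Sz.
(* The points are moved to their targets one at a time; in [w k] the first [k] are in place. *)
pose w k : config R n d := fun i => if (i < k)%N then z i else y i.
suff Aw k : (k <= n)%N -> A (w k).
  suff -> : z = w n by exact: Aw.
  by apply/funext => i; rewrite /w ltn_ord.
elim: k => [_|k IH kn]; first by rewrite (_ : w 0%N = y).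
pose i0 := Ordinal kn.
have [v [t [uv rE]]] := rotation_transitive d2
  ((unit_sphereE _).1 (Sy i0)) ((unit_sphereE _).1 (Sz i0)).
rewrite (_ : w k.+1 = config_rotation i0 (rotation (y i0) v t) (w k)).
  by apply: stA; [exists i0, (y i0), v, t|exact/IH/ltnW].
apply/funext => j; rewrite /config_rotation /w ltnS leq_eqVlt.
have [->|ji] := eqVneq j i0; first by rewrite /= eqxx ltnn rE.
rewrite (_ : (j == k :> nat) = false)//; apply/negP => /eqP jk.
by move/negP: ji; apply; apply/eqP/val_inj.
Qed.

Lemma finite_type_fun_entry {R : realType} n d (i : 'I_n) (k : 'I_d) :
  finite_type_fun (@config_rotations R n d) (fun y => y i k 0).
Proof.
exists d, (fun y => y i), (delta_mx 0 k); split=> [j|_ [i0 [u [v [t [uv ->]]]]]|y].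
- exact: (measurableT_comp (measurable_borel_entry j 0) (@measurable_coord R n d i)).
- rewrite /config_rotation; case: (i == i0); first by exists (rotation u v t).
  by exists 1%:M => y; rewrite mul1mx.
- by rewrite -rowE mxE.
Qed.

(** * Negligibility for independent uniform points *)

Lemma independent_rectangle {R : realType} n d (dO : measure_display)
    (Omega : measurableType dO) (P : probability Omega R)
    (x : 'I_n -> {RV P >-> borel_cV R d}) (B : 'I_n -> set (borel_cV R d)) :
  mutually_independent x -> (forall i, measurable (B i)) ->
  P [set w | forall i, B i (x i w)] = (\prod_i distribution P (x i) (B i))%E.
Proof.
move=> xind mB.
transitivity (\prod_(i in [set: 'I_n]%SET) P (x i @^-1` B i))%E.
  rewrite -xind//; congr (P _); apply/seteqP; split=> [w Bw i _|w Bw i]; first exact: Bw.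
  by apply: Bw; rewrite /= inE.
by apply: eq_bigl => i; rewrite inE.
Qed.

Lemma sphere_finite_type_negligible {R : realType} n d (dO : measure_display)
    (Omega : measurableType dO) (P : probability Omega R)
    (x : 'I_n -> {RV P >-> borel_cV R d}) (q : config R n d -> R) :
  (2 <= d)%N -> mutually_independent x ->
  (forall i, uniform_on_sphere (distribution P (x i))) ->
  finite_type_fun (@config_rotations R n d) q ->
  (exists2 y, @sphere_config R n d y & q y != 0) ->
  P.-negligible [set w | q (fun i => x i w) = 0].
Proof.
move=> d2 xind xunif qft qn0.
pose X (w : Omega) : config R n d := fun i => x i w.
have mX : measurable_fun setT X by apply: measurable_config => i; exact: measurable_funPT.
pose XRV : {RV P >-> config R n d} := HB.pack X (isMeasurableFun.Build _ _ _ _ X mX).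
have mS : measurable (@unit_sphere R d : set (borel_cV R d)).
  rewrite (_ : @unit_sphere R d = (fun v : borel_cV R d => dotv v v) @^-1` [set 1]).
    rewrite -[_ @^-1` _]setTI; apply: (_ : measurable_fun setT _) => //.
    under eq_fun do rewrite dotvE.
    by apply: measurable_sum => j; apply: measurable_funM; exact: measurable_borel_entry.
  by apply/seteqP; split=> v /unit_sphereE.
have [|||||mq q0] := @finite_type_fun_null _ _ _ (distribution P XRV) _
  (@sphere_config R n d) q _ _ _ _ _ qft qn0.
- move=> g [i [u [v [t [uv ->]]]]]; set Q := rotation u v t.
  have mQ : measurable_fun setT (@config_rotation R n d i Q).
    apply: measurable_config => j; rewrite /config_rotation.
    case: (j == i); last exact: measurable_coord.
    exact: (measurableT_comp (measurable_borel_mulmx _) (@measurable_coord R n d j)).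
  split=> // A mA.
  have mQX : measurable_fun setT (config_rotation i Q \o X) by exact: measurableT_comp.
  pose QXRV : {RV P >-> config R n d} :=
    HB.pack (config_rotation i Q \o X) (isMeasurableFun.Build _ _ _ _ _ mQX).
  apply: (config_probability_eq (m1 := distribution P QXRV) (m2 := distribution P XRV)) => //.
  (* The preimage of a rectangle is a rectangle with only the side [i] changed, so the invariance of
     the law of one point suffices. *)
  move=> B mB; pose C j : set (borel_cV R d) :=
    if j == i then [set z : borel_cV R d | B j (Q *m z)] else B j.
  have mC j : measurable (C j).
    rewrite /C; case: ifP => // _; rewrite -[X in measurable X]setTI.
    exact: measurable_borel_mulmx.
  transitivity (P [set w | forall j, C j (x j w)]).
    congr (P _); apply/seteqP.
    by split=> w BQ j; have := BQ j; rewrite /C /= /config_rotation /X; case: (j == i).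
  rewrite independent_rectangle// [RHS](independent_rectangle xind mB).
  apply: eq_bigr => j _; rewrite /C; case: ifP => // _.
  have [_ inv] := xunif j; apply: inv => //; exact: rotation_orthogonal.
- exact: config_rotations_root.
- exact: (@measurable_rectangle R n d (fun=> @unit_sphere R d) (fun=> mS)).
- rewrite [LHS](independent_rectangle xind (fun=> mS)) big1// => i _.
  by have [] := xunif i.
- by move=> A stA; exact: config_rotations_transitive.
exists (X @^-1` [set y | q y = 0]); split => //.
by rewrite -[_ @^-1` _]setTI; exact: (mX measurableT _ mq).
Qed.

(** * Affine dependencies *)

(** The added coordinate 1 turns affine dependencies into linear ones. *)
Definition homogenize {R : realType} {d} (v : 'cV[R]_d) : 'cV[R]_(1 + d) :=
  col_mx 1%:M v.

Definition affine_frame {R : realType} {d} (y : config R d.+2 d) : 'M[R]_(1 + d) :=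
  \matrix_(k, j) homogenize (y (lift ord0 j)) k 0.

(** Cramer's rule with the adjugate for the inverse, which keeps the coefficients polynomial; the
    first point then has the coefficient [- \det (affine_frame y)]. *)
Definition affine_coef {R : realType} {d} (y : config R d.+2 d) : 'cV[R]_(1 + d) :=
  \adj (affine_frame y) *m homogenize (y ord0).

(** The first factor detects affine independence of the points other than the first; the second is
    nonzero when the kernel of the Laplacian consists of invariant vectors. *)
Definition affine_test {R : realType} {d N} (p : 'I_(1 + d) -> 'S_N)
    (y : config R d.+2 d) : R :=
  \det (affine_frame y) * perm_det p (fun j => affine_coef y j 0).

Lemma finite_type_fun_affine_test {R : realType} d N (p : 'I_(1 + d) -> 'S_N) :
  finite_type_fun (@config_rotations R d.+2 d) (affine_test p).
Proof.
pose C := config R d.+2 d.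
have fhom i k : finite_type_fun (@config_rotations R d.+2 d)
    (fun y : C => homogenize (y i) k 0).
  rewrite /homogenize; case: (split_ordP k) => l ->.
    apply: (finite_type_fun_eq (q1 := fun=> (1%:M : 'M[R]_1) l 0)) => [y|].
      by rewrite col_mxEu.
    exact: finite_type_fun_cst.
  apply: (finite_type_fun_eq (q1 := fun y : C => y i l 0)) => [y|].
    by rewrite col_mxEd.
  exact: finite_type_fun_entry.
have fframe i j : finite_type_fun (@config_rotations R d.+2 d)
    (fun y : C => affine_frame y i j).
  apply: (finite_type_fun_eq (q1 := fun y : C => homogenize (y (lift ord0 j)) i 0)) => [y|//].
  by rewrite [RHS]mxE.
have fcoef j : finite_type_fun (@config_rotations R d.+2 d)
    (fun y : C => affine_coef y j 0).
  apply: (finite_type_fun_eq (q1 := fun y : C =>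
    \sum_l \adj (affine_frame y) j l * homogenize (y ord0) l 0)) => [y|].
    by rewrite [RHS]mxE.
  by apply: finite_type_fun_sum => l; apply: finite_type_funM => //; exact: finite_type_fun_adj.
apply: finite_type_funM; apply: finite_type_fun_det => // i j.
apply: (finite_type_fun_eq (q1 := fun y : C =>
  \sum_k affine_coef y k 0 * ((1%:M - perm_mx (p k)) i j : R) + perm_average p i j)) => [y|].
  rewrite [RHS]mxE; congr (_ + _); rewrite [RHS]summxE.
  by apply: eq_bigr => k _; rewrite [RHS]mxE.
apply: finite_type_funD; last exact: finite_type_fun_cst.
by apply: finite_type_fun_sum => k; apply: finite_type_funM => //; exact: finite_type_fun_cst.
Qed.

(** * A spherical configuration where the test does not vanish *)

(** The matrix is affine in [s], so its determinant is a polynomial; it is nonzero at [s = 1], where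
    all weights are equal. *)
Lemma perm_det_line {R : realFieldType} m N (p : 'I_m.+1 -> 'S_N) :
  exists2 q : {poly R}, q != 0 &
    forall s, q.[s] = perm_det p (fun j => if j == ord0 then s else 1).
Proof.
pose D : 'M[R]_N := 1%:M - perm_mx (p ord0).
pose E : 'M[R]_N := \sum_(j < m) (1%:M - perm_mx (p (lift ord0 j))) + perm_average p.
pose Q : 'M[{poly R}]_N := \matrix_(i, j) ('X * (D i j)%:P + (E i j)%:P).
have detQ s : (\det Q).[s] = perm_det p (fun j => if j == ord0 then s else 1).
  rewrite -[LHS]/(horner_eval s (\det Q)) -det_map_mx /perm_det.
  congr (\det _); apply/matrixP => i j.
  rewrite [LHS]mxE /= /horner_eval (mxE _ _ i j) !hornerE /=.
  rewrite /perm_laplacian big_ord_recl /=; under eq_bigr do rewrite scale1r.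
  by rewrite -addrA [RHS]mxE [in RHS]mxE.
exists (\det Q) => //; apply/eqP => Q0.
have := perm_det1_neq0 (R := R) p.
rewrite (_ : (fun=> 1) = (fun j => if j == ord0 then 1 else 1)).
  by rewrite -detQ Q0 horner0 eqxx.
by apply/funext => j; case: ifP.
Qed.

Lemma poly_not_all_roots {R : idomainType} (q : {poly R}) (f : nat -> R) :
  q != 0 -> injective f -> exists k, q.[f k] != 0.
Proof.
move=> q0 finj; apply: contrapT => allroots.
have : (size [seq f k | k <- iota 0 (size q)] < size q)%N.
  apply: max_poly_roots => //; last by rewrite map_inj_uniq ?iota_uniq.
  apply/allP => _ /mapP[k _ ->]; rewrite rootE; apply: contrapT => qk.
  by apply: allroots; exists k; exact/negP.
by rewrite size_map size_iota ltnn.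
Qed.

(* Two points of the sphere on a line through the centroid of the standard
   basis: [x] has coordinate sum [a], and [z] is the second intersection of the
   sphere with the line from [x] through the centroid. *)
Lemma sphere_chord {R : realType} d (a s : R) : (2 <= d)%N -> 0 < a < 1 ->
  s = d%:R * (2 * a - d%:R - 1) / (2 * (d%:R - a)) ->
  exists x z : 'cV[R]_d,
    [/\ dotv x x = 1, dotv z z = 1, dotv (const_mx 1) z != 1,
        s *: z + const_mx 1 = (d%:R + s) *: x & d%:R + s != 0].
Proof.
case: d => [|[|d]]// _ /andP[a0 a1] sE.
have [n nE] : exists n : R, d.+2%:R = n by exists d.+2%:R.
have n2 : 2 <= n by rewrite -nE ler_nat.
move: sE; rewrite !nE => sE.
have na : n - a != 0 by rewrite gt_eqF//; lra.
have nsE : n + s = n * (n - 1) / (2 * (n - a)) by rewrite sE; field.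
have ns0 : n + s != 0.
  rewrite nsE gt_eqF// divr_gt0// ?mulr_gt0//; lra.
have s0 : s != 0.
  rewrite sE !mulf_neq0// ?invr_neq0 ?mulf_neq0//; last by rewrite lt_eqF//; lra.
  by rewrite gt_eqF//; lra.
pose r := Num.sqrt (2 - a ^+ 2).
have r2 : r ^+ 2 = 2 - a ^+ 2.
  by rewrite sqr_sqrtr// subr_ge0; nra.
pose e k : 'cV[R]_d.+2 := delta_mx k 0.
pose one : 'cV[R]_d.+2 := const_mx 1.
have ee k l : dotv (e k) (e l) = (k == l)%:R.
  rewrite dotvE (bigD1 k)//= big1 ?addr0 => [|i /negPf ik]; last first.
    by rewrite !mxE ik mul0r.
  by rewrite !mxE !eqxx /= andbT mulr1n mul1r.
have onee k : dotv one (e k) = 1.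
  rewrite dotvE (bigD1 k)//= big1 ?addr0 => [|i /negPf ik]; last first.
    by rewrite !mxE ik mulr0.
  by rewrite !mxE !eqxx mulr1n mul1r.
have oneone : dotv one one = n.
  by rewrite dotvE (eq_bigr (fun=> 1)) ?sumr_const ?card_ord// => i _; rewrite !mxE mulr1.
(* The coefficients have sum [a] and sum of squares [(a ^+ 2 + r ^+ 2) / 2 = 1]. *)
pose x := ((a + r) / 2) *: e 0 + ((a - r) / 2) *: e 1.
have xx : dotv x x = 1.
  by rewrite /x !dotvDl !dotvDr !dotvZl !dotvZr !ee/=; lra.
have onex : dotv one x = a by rewrite /x dotvDr !dotvZr !onee; lra.
move: x xx onex => x xx onex.
exists x, (s^-1 *: ((n + s) *: x - one)); split => //.
- rewrite !(dotvZl, dotvZr, dotvDl, dotvDr, dotvNl, dotvNr) xx (dotvC x) onex oneone.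
  (* The value of [s] is the one for which [(n + s) *: x - one] has norm [|s|]. *)
  have key : 2 * (n - a) * s = n * (2 * a - n - 1) by rewrite sE; field.
  rewrite (_ : (n + s) * ((n + s) * 1 - a) - ((n + s) * a - n) = s * s); last by nra.
  by field.
- rewrite !(dotvZr, dotvDr, dotvNr) onex oneone.
  apply/eqP => /(congr1 ( *%R s)); rewrite mulrA divff// mul1r mulr1 => sE'.
  have : (n + s) * (a - 1) = 0 by rewrite mulrBr mulr1 -{2}sE'; ring.
  by apply/eqP; rewrite mulf_neq0// lt_eqF// subr_lt0.
- by rewrite scalerA divff// scale1r subrK.
Qed.

Lemma affine_test_neq0 {R : realType} d N (p : 'I_(1 + d) -> 'S_N) : (2 <= d)%N ->
  exists2 y, @sphere_config R d.+2 d y & affine_test p y != 0.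
Proof.
move=> d2; have [q q0 qE] := perm_det_line (R := R) p.
have [a [a01 ainj]] : exists a : nat -> R, (forall k, 0 < a k < 1) /\ injective a.
  exists (fun k => k.+2%:R^-1); split=> [k|k l /invr_inj/eqP].
    by rewrite invr_gt0 ltr0n /= invf_lt1 ?ltr0n// ltr1n.
  by rewrite eqr_nat => /eqP[].
pose s k : R := d%:R * (2 * a k - d%:R - 1) / (2 * (d%:R - a k)).
have dR : 2 <= d%:R :> R by rewrite ler_nat.
have da k : d%:R - a k != 0 by have /andP[a0 a1] := a01 k; rewrite gt_eqF//; lra.
have [k qk] : exists k, q.[s k] != 0.
  apply: (poly_not_all_roots q0) => k l skl.
  (* Distinct [a k] give distinct [s k], as [a j] is recovered from [d%:R + s j]. *)
  have sE j : d%:R * (d%:R - 1) / (d%:R + s j) = 2 * (d%:R - a j).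
    rewrite /s; have := da j; have /andP[] := a01 j; move: (a j) => b b0 b1 db.
    field; rewrite db /=; apply/eqP; nra.
  have /eqP : 2 * (d%:R - a k) = 2 * (d%:R - a l) by rewrite -!sE skl.
  by move/eqP => kl; apply: ainj; lra.
have [x [z [xx zz z1 szx ds0]]] := sphere_chord d2 (a01 k) (erefl (s k)).
pose y : config R d.+2 d := fun i =>
  if unlift ord0 i is Some j then
    (if unlift ord0 (j : 'I_d.+1) is Some l then delta_mx l 0 else z) else x.
have y0 : y ord0 = x by rewrite /y unlift_none.
have y1 : y (lift ord0 ord0) = z by rewrite /y liftK unlift_none.
have y2 l : y (lift ord0 (lift ord0 l)) = delta_mx l 0 by rewrite /y !liftK.
exists y.
  move=> i; apply/unit_sphereE; rewrite /y.
  case: (unliftP ord0 i) => [j _|_//]; case: (unliftP ord0 j) => [l _|_//].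
  rewrite dotvE (bigD1 l)//= big1 ?addr0 => [|m /negPf ml].
    by rewrite !mxE !eqxx mulr1.
  by rewrite !mxE ml mul0r.
have l0 (l : 'I_1) : lshift d l = ord0 :> 'I_d.+1 by apply: val_inj; rewrite /= ord1.
have r0 l : rshift 1 l = lift ord0 l :> 'I_d.+1 by exact: val_inj.
have frameE : affine_frame y = block_mx 1%:M (const_mx 1) z 1%:M.
  apply/matrixP => i j; rewrite mxE.
  case: (split_ordP j) => l ->.
    rewrite (_ : y _ = z); last by rewrite l0 y1.
    by case: (split_ordP i) => m ->; rewrite ?col_mxEu ?col_mxEd row_mxEl (ord1 l).
  rewrite (_ : y _ = delta_mx l 0); last by rewrite r0 y2.
  case: (split_ordP i) => m ->; rewrite ?col_mxEu ?col_mxEd row_mxEr.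
    by rewrite !mxE (ord1 m).
  by rewrite !mxE eqxx andbT.
(* The Schur complement of the lower identity block is [1 - dotv (const_mx 1) z], nonzero by
   [z1]. *)
have det0 : \det (affine_frame y) != 0.
  apply/negP => /det0P[v]; rewrite -(hsubmxK v) frameE mul_row_block.
  move: (lsubmx v) (rsubmx v) => al b; rewrite (mx11_scalar al); move: (al 0 0) => {}al.
  rewrite !mulmx1 => ab0 /eqP; rewrite row_mx_eq0 => /andP[/eqP al0 /eqP b0].
  have bE : b = - (al *: (const_mx 1)^T).
    by apply/eqP; rewrite -subr_eq0 opprK addrC -b0 mul_scalar_mx trmx_const.
  have : al * (1 - dotv (const_mx 1) z) = 0.
    have /matrixP/(_ 0 0) := al0; rewrite bE mulNmx -scalemxAl tr_mulmx_dotv => H.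
    by move: H; rewrite !mxE !eqxx !mulr1n => <-; ring.
  move/eqP; rewrite mulf_eq0 subr_eq0 [1 == _]eq_sym (negPf z1) orbF => /eqP alE.
  move/eqP: ab0; apply; rewrite bE alE scale0r oppr0 (_ : 0%:M = 0) ?row_mx0//.
  by apply/matrixP => i j; rewrite !mxE mul0rn.
rewrite mulf_neq0//.
pose c : 'cV[R]_(1 + d) := col_mx (s k)%:M (const_mx 1).
have coefE : affine_coef y = (\det (affine_frame y) / (d%:R + s k)) *: c.
  rewrite /affine_coef y0.
  have -> : homogenize x = (d%:R + s k)^-1 *: (affine_frame y *m c).
    rewrite frameE mul_block_col !mul1mx mul_mx_scalar szx scale_col_mx scalerA mulVf// scale1r.
    congr col_mx; apply/matrixP => i j; rewrite !ord1 !mxE (eq_bigr (fun=> 1)) => [|m _].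
      by rewrite sumr_const card_ord !eqxx mulr1n addrC mulVf.
    by rewrite !mxE mulr1.
  by rewrite -scalemxAr mulmxA mul_adj_mx mul_scalar_mx scalerA mulrC.
rewrite (_ : (fun j => _) = (fun j => \det (affine_frame y) / (d%:R + s k) *
    (if j == ord0 then s k else 1))); last first.
  apply/funext => j; rewrite coefE mxE; congr (_ * _).
  case: (@split_ordP 1 d j) => l ->; first by rewrite col_mxEu mxE !ord1 eqxx mulr1n l0.
  by rewrite col_mxEd mxE r0.
apply: perm_det_scale; last by rewrite -qE.
by rewrite mulf_neq0// invr_neq0.
Qed.

(* Inner products of vectors are determined by the pairwise distances of the
   vectors and of the origin, hence so is the norm of a linear combination. *)
Lemma isometric_relation {R : realType} n m (I : finType) (c : I -> R)
    (v : I -> 'cV[R]_n) (w : I -> 'cV[R]_m) :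
  (forall j, dotv (v j) (v j) = dotv (w j) (w j)) ->
  (forall j l, dotv (v j - v l) (v j - v l) = dotv (w j - w l) (w j - w l)) ->
  \sum_j c j *: v j = 0 -> \sum_j c j *: w j = 0.
Proof.
move=> vw dvw v0; apply/eqP; rewrite -dotvv_eq0.
suff -> : dotv (\sum_j c j *: w j) (\sum_j c j *: w j) =
          dotv (\sum_j c j *: v j) (\sum_j c j *: v j) by rewrite v0 dotvv_eq0.
have vwE j l : dotv (w j) (w l) = dotv (v j) (v l).
  have := dvw j l; rewrite !(dotvDl, dotvDr, dotvNl, dotvNr) !vw.
  by rewrite (dotvC (v l)) (dotvC (w l)); lra.
rewrite !dotv_suml; apply: eq_bigr => j _; rewrite !dotv_sumr.
by apply: eq_bigr => l _; rewrite !(dotvZl, dotvZr) vwE.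
Qed.

(** * Distance-preserving permutations of a transitive set *)

Definition perm_isometry {R : realType} {M n} (tau : 'I_M -> 'cV[R]_n)
    (h : 'S_M) : bool :=
  [forall a, forall b,
    dotv (tau (h a) - tau (h b)) (tau (h a) - tau (h b)) ==
    dotv (tau a - tau b) (tau a - tau b)].

Lemma perm_isometryP {R : realType} M n (tau : 'I_M -> 'cV[R]_n) (h : 'S_M) :
  reflect (forall a b,
    dotv (tau (h a) - tau (h b)) (tau (h a) - tau (h b)) =
    dotv (tau a - tau b) (tau a - tau b)) (perm_isometry tau h).
Proof.
by apply: (iffP forallP) => H a; [move=> b; apply/eqP/(forallP (H a))|
  apply/forallP => b; apply/eqP].
Qed.

Lemma perm_isometry1 {R : realType} M n (tau : 'I_M -> 'cV[R]_n) :
  perm_isometry tau 1%g.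
Proof. by apply/perm_isometryP => a b; rewrite !perm1. Qed.

Lemma perm_isometryM {R : realType} M n (tau : 'I_M -> 'cV[R]_n) (s h : 'S_M) :
  perm_isometry tau s -> perm_isometry tau (s * h)%g = perm_isometry tau h.
Proof.
move=> /perm_isometryP sP; apply/perm_isometryP/perm_isometryP => hP a b.
  have := hP (s^-1%g a) (s^-1%g b); rewrite !permM !permKV => ->.
  by have := sP (s^-1%g a) (s^-1%g b); rewrite !permKV.
by rewrite !permM hP sP.
Qed.

(** Once [T] is numbered without repetition, an isometry of [T] onto itself becomes a permutation of
    the indices, injective because distances are preserved. *)
Lemma transitive_set_enum {R : realType} n (T : set 'cV[R]_n) : transitive_set T ->
  exists (M : nat) (tau : 'I_M -> 'cV[R]_n),
    (forall t, T t -> exists j, tau j = t) /\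
    forall j k, exists2 s : 'S_M, perm_isometry tau s & s j = k.
Proof.
move=> [/finite_seqP[r0 rE] trT].
pose r := undup r0.
have Tr t : T t <-> t \in r by rewrite rE /= mem_undup.
pose tau (j : 'I_(size r)) : 'cV[R]_n := nth 0 r j.
have tauT j : T (tau j) by apply/Tr/mem_nth.
have Ttau t : T t -> exists j, tau j = t.
  by move=> /Tr tr; have tr' := tr; rewrite -index_mem in tr';
     exists (Ordinal tr'); exact: nth_index.
have tau_inj : injective tau.
  move=> j k /eqP; rewrite nth_uniq ?undup_uniq// => /eqP jk; exact: val_inj.
exists (size r), tau; split => // j k.
have [g [isog gT gjk]] := trT _ _ (tauT j) (tauT k).
have /choice[s sE] : forall a, exists b, tau b = g (tau a).
  by move=> a; apply: Ttau; rewrite -gT; exists (tau a).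
have s_inj : injective s.
  move=> a b sab; apply: tau_inj; apply/eqP; rewrite -subr_eq0 -dotvv_eq0.
  by rewrite -(enorm_inj (isog _ _)) -!sE sab subrr dotvv_eq0.
exists (perm s_inj).
  by apply/perm_isometryP => a b; rewrite !permE !sE; apply: enorm_inj; exact: isog.
by rewrite permE; apply: tau_inj; rewrite sE.
Qed.

Lemma affine_frame_coef {R : realType} d (y : config R d.+2 d) :
  \sum_j affine_coef y j 0 *: homogenize (y (lift ord0 j)) =
  \det (affine_frame y) *: homogenize (y ord0).
Proof.
rewrite -[RHS]mul_scalar_mx -mul_mx_adj -mulmxA -/(affine_coef y).
apply/matrixP => i k; rewrite ord1 summxE [RHS]mxE; apply: eq_bigr => j _.
by rewrite [LHS]mxE mulrC; congr (_ * _); rewrite [RHS]mxE.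
Qed.

(** The left regular action of the whole symmetric group, so that the size of the matrices depends
    on [M] only. *)
Definition left_mul_perm {M} (s : 'S_M) : 'S_#|{perm 'I_M}| :=
  perm (can_inj (f := fun i => enum_rank (s * enum_val i)%g)
    (g := fun i => enum_rank (s^-1 * enum_val i)%g)
    (fun i => etrans (congr1 (fun h => enum_rank (s^-1 * h)%g) (enum_rankK _))
       (etrans (congr1 enum_rank (mulKg s (enum_val i))) (enum_valK i)))).

Lemma left_mul_permE {M} (s h : 'S_M) :
  left_mul_perm s (enum_rank h) = enum_rank (s * h)%g.
Proof. by rewrite permE enum_rankK. Qed.

Lemma affinely_subtransitive_affine_test {R : realType} d (y : config R d.+2 d) :
  affinely_subtransitive [set y i | i in [set: 'I_d.+2]] ->
  exists N (p : 'I_(1 + d) -> 'S_N), affine_test p y = 0.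
Proof.
move=> [n [T [f [/transitive_set_enum[M [tau [Ttau trtau]]] [A [b fE]] ncf fT]]]].
have Tf i : T (f (y i)) by apply: fT; exists (y i) => //; exists i.
have [j0 j0E] := Ttau _ (Tf ord0).
have /choice[k kE] : forall j, exists k, tau k = f (y (lift ord0 j)).
  by move=> j; exact: Ttau.
have /choice[s /all_and2[isos sE]] : forall j, exists s : 'S_M, perm_isometry tau s /\ s j0 = k j.
  by move=> j; have [s ? ?] := trtau j0 (k j); exists s.
exists #|{perm 'I_M}|, (fun j => left_mul_perm (s j)).
apply/eqP; rewrite mulf_eq0; apply: contrapT => /negP; rewrite negb_or => /andP[det0 pdet0].
pose t := f (y ord0); pose B := row_mx (b - t) A.
have BE v : B *m homogenize v = f v - t.
  by rewrite mul_row_col mulmx1 fE addrC addrA.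
(* [B] annihilates the homogenized first point, so Cramer's relation becomes one between
   differences. *)
have dep : \sum_j affine_coef y j 0 *: (tau j0 - tau (s j j0)) = 0.
  have := congr1 (mulmx B) (affine_frame_coef y).
  rewrite mulmx_sumr -scalemxAr BE subrr scaler0 => dep.
  apply: oppr_inj; rewrite oppr0 -[RHS]dep -sumrN; apply: eq_bigr => j _.
  by rewrite -scalemxAr BE sE kE j0E -scalerN opprB.
have const j : f (y (lift ord0 j)) = t.
  rewrite -kE -sE /t -j0E; apply/matrixP => l l'; rewrite ord1 {l'}.
  (* One coordinate of [tau (h j0)] as a function of [h], extended by 0 off the distance-preserving
     permutations, a set stable under left multiplication by each [s j]. Products compose from left
     to right: [(s j * h) j0] is [h (s j j0)]. *)
  pose F : 'cV[R]_#|{perm 'I_M}| := \col_i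
    if perm_isometry tau (enum_val i) then tau (enum_val i j0) l 0 else 0.
  have FE (p : 'S_M) i :
      (perm_mx (left_mul_perm p) *m F) (enum_rank i) 0 = F (enum_rank (p * i)%g) 0.
    by rewrite -row_permE mxE left_mul_permE.
  have LE (a : R) (p : 'S_M) i :
      (a *: (1%:M - perm_mx (left_mul_perm p)) *m F) (enum_rank i) 0 =
      a * (F (enum_rank i) 0 - F (enum_rank (p * i)%g) 0).
    rewrite -scalemxAl mulmxBl mul1mx [LHS]mxE; congr (_ * _).
    by rewrite [LHS]mxE; congr (_ + _); rewrite [LHS]mxE FE.
  have LF : perm_laplacian (fun j => left_mul_perm (s j)) (fun j => affine_coef y j 0) *m F = 0.
    apply/matrixP => i i'; rewrite ord1 {i'} -(enum_valK i); move: (enum_val i) => {}i.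
    rewrite mulmx_suml summxE [RHS]mxE.
    have [isoi|/negPf nisoi] := boolP (perm_isometry tau i); last first.
      rewrite big1// => h _.
      by rewrite LE !mxE !enum_rankK perm_isometryM// nisoi subrr mulr0.
    (* The vectors in [dep] share an origin, so their differences are differences of points too, and
       [i] preserves the norms of all of these. *)
    have dep' : \sum_h affine_coef y h 0 *: (tau (i j0) - tau (i (s h j0))) = 0.
      move/perm_isometryP: isoi => isoi.
      apply: isometric_relation dep => [h|h h']; first by rewrite isoi.
      have E (u v w : 'cV[R]_n) : (u - v) - (u - w) = w - v.
        by apply/matrixP => ? ?; rewrite !mxE; ring.
      by rewrite !E isoi.
    have /matrixP/(_ l 0) := dep'; rewrite summxE mxE => dep0; rewrite -[RHS]dep0.
    apply: eq_bigr => h _.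
    by rewrite LE !mxE !enum_rankK perm_isometryM// isoi permM.
  (* Invariance, read at the identity permutation, equates the coordinates of [tau (s j j0)] and
     [tau j0]. *)
  have /(_ j)/matrixP/(_ (enum_rank 1%g) 0) := perm_kernel_invariant pdet0 LF.
  by rewrite FE !mxE !enum_rankK mulg1 isos perm_isometry1 perm1.
(* [B] vanishes on the columns of the frame, which is invertible. *)
have B0 : B = 0.
  have BF : B *m affine_frame y = 0.
    apply/matrixP => i j; rewrite [RHS]mxE.
    transitivity ((B *m homogenize (y (lift ord0 j))) i 0).
      by rewrite !mxE; apply: eq_bigr => l _; congr (_ * _); rewrite [LHS]mxE.
    by rewrite BE const subrr mxE.
  have U : affine_frame y \in unitmx by rewrite unitmxE unitfE.
  by rewrite -(mulmxK U B) BF mul0mx.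
have [u [v]] := ncf; apply.
have ft w : f w = t by apply/eqP; rewrite -subr_eq0 -BE B0 mul0mx.
by rewrite !ft.
Qed.

(** * Countable union of the exceptional sets *)

Lemma negligible_countable_bigcup {d} {T : measurableType d} {R : realType}
    (mu : {measure set T -> \bar R}) (U : countType) (F : U -> set T) :
  (forall u, mu.-negligible (F u)) -> mu.-negligible (\bigcup_u F u).
Proof.
move=> F0; pose G k := if unpickle k is Some u then F u else set0.
have : mu.-negligible (\bigcup_k G k).
  apply: negligible_bigcup => k; rewrite /G.
  by case: unpickle => [u|]; [exact: F0|exact: negligible_set0].
apply: negligibleS => w [u _ Fu]; exists (pickle u); first by [].
by rewrite /G pickleK.
Qed.

Theorem mainTheorem1 (R : realType) (d : nat) (d_ge2 : (2 <= d)%N)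
    (dO : measure_display) (Omega : measurableType dO) (P : probability Omega R)
    (x : 'I_d.+2 -> {RV P >-> borel_cV R d})
    (x_indep : mutually_independent x)
    (x_unif : forall i : 'I_d.+2, uniform_on_sphere (distribution P (x i))) :
  {ae P, forall w, ~ affinely_subtransitive [set x i w | i in [set: 'I_d.+2]]}.
Proof.
pose Z N (p : {ffun 'I_(1 + d) -> 'S_N}) : set Omega :=
  [set w | affine_test p ((fun i => x i w) : config R d.+2 d) = 0].
have Z0 N p : P.-negligible (@Z N p).
  apply: (sphere_finite_type_negligible d_ge2 x_indep x_unif).
    exact: finite_type_fun_affine_test.
  exact: affine_test_neq0.
(* The size [N] varies with [T]; for each [N] the tuples of permutations form a finite type, so the
   pairs are countable. *)
pose U : countType := {N : nat & {ffun 'I_(1 + d) -> 'S_N}}.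
have := negligible_countable_bigcup (fun u : U => Z0 (tag u) (tagged u)).
apply: negligibleS => w /= /contrapT.
move=> /(affinely_subtransitive_affine_test (y := fun i => x i w))[N [p pw]].
exists (Tagged (fun N => {ffun 'I_(1 + d) -> 'S_N}) [ffun j => p j]); first by [].
rewrite /= /Z /=.
have -> : ([ffun j => p j] : 'I_(1 + d) -> 'S_N) = p by apply/funext => j; rewrite ffunE.
exact: pw.
Qed.
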